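(* For each positive integer $n$, place $n^2$ line-queens at random on the $3$-dimensional chessboard with side length $n$. Then, as $n\to\infty$, the expected proportion of safe spaces converges to $$\frac{-1+9e^2-2e^3}{3e^9}.$$
   Context: The $3$-dimensional board of side length $n$ is the set of spaces $\{1,\dots,n\}^3$. ''Placing $n^2$ pieces at random'' means that the set of occupied spaces (the board configuration) is chosen uniformly among all $\binom{n^3}{n^2}$ subsets of $n^2$ distinct spaces. A line-queen attacks every space that a line-rook or a line-bishop at the same position would attack. A line-rook attacks every space that agrees with its position in all but one coordinate. A line-bishop at $(a_1,a_2,a_3)$ attacks $(x_1,x_2,x_3)$ if there are two distinct indices $i,j$ with $|x_i-a_i|=|x_j-a_j|$ while the remaining coordinate of the two spaces is equal. A space is safe under a board configuration if it is neither occupied nor attacked by any of the placed pieces. The expected proportion of safe spaces is the expected number of safe spaces divided by $n^3$. *)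

(* Defs.v *)
From HB Require Import structures.
From mathcomp Require Import all_boot all_order all_algebra.
From mathcomp Require Import all_classical all_reals all_analysis.

Set Implicit Arguments.
Unset Strict Implicit.
Unset Printing Implicit Defensive.

Import Order.TTheory GRing.Theory Num.Theory.

Local Open Scope ring_scope.

(* The spaces of the 3-dimensional board of side length n.  Coordinates run
   over 0, ..., n-1 instead of 1, ..., n: attacks only involve equalities and
   differences of coordinates, so the shift is immaterial. *)
Definition space (n : nat) := {ffun 'I_3 -> 'I_n}.

Definition coord_dist n (a x : space n) (i : 'I_3) : int :=
  `|(x i : nat)%:Z - (a i : nat)%:Z|.

Definition line_rook_attacks n (a x : space n) : bool :=
  [exists i, (x i != a i) && [forall k, (k != i) ==> (x k == a k)]].

(* This relation also holds at a = x, with both distances zero; that is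
   immaterial for safety, since an occupied space is never safe. *)
Definition line_bishop_attacks n (a x : space n) : bool :=
  [exists i, exists j,
    [&& i != j, coord_dist a x i == coord_dist a x j &
        [forall k, (k != i) && (k != j) ==> (x k == a k)]]].

Definition line_queen_attacks n (a x : space n) : bool :=
  line_rook_attacks a x || line_bishop_attacks a x.

Definition safe_spaces n (A : {set space n}) : {set space n} :=
  [set x | (x \notin A) && [forall a in A, ~~ line_queen_attacks a x]].

(* Probability of the board configuration A when the set of occupied spaces is
   uniform among the sets of m distinct spaces. *)
Definition placement_prob (R : realType) (n m : nat) (A : {set space n}) : R :=
  if #|A| == m then ('C((n ^ 3)%N, m)%:R)^-1 else 0.

Definition expected_safe_count (R : realType) (n m : nat) : R :=
  \sum_(A : {set space n}) placement_prob R m A * #|safe_spaces A|%:R.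

Definition expected_safe_proportion (R : realType) (n m : nat) : R :=
  expected_safe_count R n m / (n ^ 3)%N%:R.

(* Main.v *)
Require Import Defs.
From mathcomp Require Import all_boot all_order all_algebra.
From mathcomp Require Import all_classical all_reals all_analysis.
From mathcomp Require Import zify ring lra.

Set Implicit Arguments.
Unset Strict Implicit.
Unset Printing Implicit Defensive.

Import Order.TTheory GRing.Theory Num.Theory.
Import numFieldNormedType.Exports.

Local Open Scope classical_set_scope.
Local Open Scope ring_scope.

(** By linearity of expectation the expected proportion is the average over the
    spaces x of C(n^3 - D(x), n^2) / C(n^3, n^2), where D(x) is the number of
    spaces attacking x (x included), and this quotient is exp(- D(x) / n) up to a
    factor tending to 1 uniformly in x.  The three rook lines and six bishop
    lines through x give
      D(x) = 9n - 8 - (max(M1, M2) + max(M2, M3) + max(M1, M3))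
    with Mi = |2 xi - (n - 1)|.  Up to an error of at most 1, a permutation of the
    coordinates turns each Mi into a coordinate running over 0, ..., n-1, so no
    integral is needed: the sum over i, j, k < n of
    q^(max(i,j) + max(j,k) + max(i,k)) at q = e^(1/n) has a closed form, and
    n (e^(c/n) - 1) --> c gives its limit. *)

(** * Sums and quantifiers over the three coordinates *)

Lemma big_space (T : Type) (idx : T) (op : Monoid.com_law idx) (n : nat)
    (F : 'I_n -> 'I_n -> 'I_n -> T) :
  \big[op/idx]_(x : Defs.space n) F (x ord0) (x (inord 1)) (x (inord 2)) =
  \big[op/idx]_(i < n) \big[op/idx]_(j < n) \big[op/idx]_(k < n) F i j k.
Proof.
under [RHS]eq_bigr => i _ do rewrite pair_big /=.
rewrite pair_big /=.
pose h (p : 'I_n * ('I_n * 'I_n)) : Defs.space n :=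
  [ffun t : 'I_3 => nth p.1 [:: p.1; p.2.1; p.2.2] t].
rewrite (reindex h) /=.
  by apply: eq_bigr => -[i [j k]] _; rewrite /h !ffunE /= !inordK.
exists (fun x => (x ord0, (x (inord 1), x (inord 2)))).
  by move=> [i [j k]] _; rewrite /h !ffunE /= !inordK.
move=> x _; apply/ffunP => t; rewrite /h ffunE /=.
by case: t => [[|[|[|t]]] lt_t] //=; congr (x _); apply/val_inj; rewrite /= ?inordK.
Qed.

Lemma forall_ord3 (P : pred 'I_3) :
  [forall i, P i] = [&& P ord0, P (inord 1) & P (inord 2)].
Proof.
apply/forallP/and3P => [H|[P0 P1 P2] i]; first by split; apply: H.
suff [->|[->|->]] : i = ord0 \/ i = inord 1 \/ i = inord 2 by [].
by case: i => [[|[|[|i]]] lt_i] //; [left|right; left|right; right];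
  apply/val_inj; rewrite /= ?inordK.
Qed.

Lemma exists_ord3 (P : pred 'I_3) :
  [exists i, P i] = [|| P ord0, P (inord 1) | P (inord 2)].
Proof.
by apply: negb_inj; rewrite negb_exists forall_ord3 !negb_or.
Qed.

(** * Counting the spaces that attack a given space *)

Definition natdist (a b : nat) : nat := ((a - b) + (b - a))%N.

Lemma coord_distE n (a x : Defs.space n) i :
  coord_dist a x i = (natdist (a i) (x i))%:Z.
Proof. by rewrite /coord_dist /natdist; lia. Qed.

(** The rook condition [x i != a i] disappears because the bishop relation already holds at
    [a = x]. *)
Lemma line_queen_attacksE n (a x : Defs.space n) (s := fun i => natdist (a i) (x i)) :
  line_queen_attacks a x =
  let s0 := s ord0 in let s1 := s (inord 1) in let s2 := s (inord 2) in
  [|| (s1 == 0) && (s2 == 0), (s0 == 0) && (s2 == 0), (s0 == 0) && (s1 == 0),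
      (s0 == 0) && (s1 == s2), (s1 == 0) && (s0 == s2)
    | (s2 == 0) && (s0 == s1)]%N.
Proof.
have E i : (x i == a i) = (s i == 0)%N by rewrite /s /natdist -val_eqE /=; apply/eqP/eqP; lia.
rewrite /line_queen_attacks /line_rook_attacks /line_bishop_attacks /=.
rewrite !exists_ord3 !forall_ord3 !coord_distE !E -!/(s _) -!val_eqE /= !inordK //=.
do !(rewrite eqz_nat).
set b0 := s _; set b1 := s _; set b2 := s _.
rewrite (eq_sym b1 b0) (eq_sym b2 b0) (eq_sym b2 b1).
case: b0 => [|a0]; case: b1 => [|a1]; case: b2 => [|a2];
  by rewrite ?eqxx //= ?andbF ?andbT ?orbF ?orbb.
Qed.

Lemma sum_interval n l h :
  (\sum_(a < n) ((l <= a) && (a < h)) = minn h n - l)%N.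
Proof.
elim: n => [|n IH]; first by rewrite big_ord0; lia.
by rewrite big_ord_recr /= IH; lia.
Qed.

Lemma sum_eq_ord n (u : 'I_n) : (\sum_(a < n) (natdist a u == 0) = 1)%N.
Proof.
rewrite -[RHS](_ : minn u.+1 n - u = 1)%N; last by have := ltn_ord u; lia.
by rewrite -sum_interval; apply: eq_bigr => a _; rewrite /natdist; lia.
Qed.

(** The candidates for [b] are v + t and v - t, each counted if it stays on the board. They coincide
    at t = 0, hence the extra term on the left. *)
Lemma sum_natdist_eq n (v : 'I_n) t :
  (\sum_(b < n) (t == natdist b v) + (t == 0) = (v + t < n) + (t <= v))%N.
Proof.
have vn := ltn_ord v.
have sing w : (\sum_(b < n) (b == w :> nat) = (w < n))%N.
  rewrite -[RHS](_ : minn w.+1 n - w = (w < n))%N; last by lia.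
  by rewrite -sum_interval; apply: eq_bigr => a _; lia.
have Et : ((t <= v) = \sum_(b < n) ((t <= v) && (b == v - t :> nat)) :> nat)%N.
  by case: leqP => tv /=; [rewrite sing; lia | rewrite big1].
have E0 : ((t == 0) = \sum_(b < n) ((t == 0) && (b == v :> nat)) :> nat)%N.
  by case: eqP => tv /=; [rewrite sing; lia | rewrite big1].
rewrite -sing Et [in LHS]E0 -!big_split /=.
by apply: eq_bigr => b _; rewrite /natdist; lia.
Qed.

(* Twice the distance |x - (n - 1) / 2| from the centre of the board. *)
Definition offcenter (n x : nat) : nat := natdist x.*2 n.-1.

(** The pairs counted form the two diagonals through (u, v) in an n by n square. *)
Lemma card_bishop_plane n (u v : 'I_n) :
  (\sum_(a < n) \sum_(b < n) (natdist a u == natdist b v) +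
    maxn (offcenter n u) (offcenter n v) + 1 = n.*2)%N.
Proof.
have [un vn] := (ltn_ord u, ltn_ord v).
(* In column [a] the candidates are v + |a - u| and v - |a - u|. Each stays on the board for an
   interval of columns; the added 1 accounts for (u, v) being hit by both. *)
have E : (\sum_(a < n) \sum_(b < n) (natdist a u == natdist b v) + 1 =
   \sum_(a < n) ((u - (n - 1 - v) <= a) && (a < u + (n - v))) +
   \sum_(a < n) ((u - v <= a) && (a < u + v.+1)))%N.
  rewrite -[X in (_ + X)%N = _](@sum_eq_ord n u) -!big_split /=.
  apply: eq_bigr => a _; rewrite sum_natdist_eq.
  have -> : (v + natdist a u < n = (u - (n - 1 - v) <= a) && (a < u + (n - v)))%N.
    by rewrite /natdist; apply/idP/andP => [|[]]; lia.
  have -> // : (natdist a u <= v = (u - v <= a) && (a < u + v.+1))%N.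
  by rewrite /natdist; apply/idP/andP => [|[]]; lia.
rewrite !sum_interval in E.
rewrite addnAC {}E /offcenter.
have maxE m : (natdist u.*2 n.-1 <= m -> natdist v.*2 n.-1 <= m ->
    (natdist u.*2 n.-1 == m) || (natdist v.*2 n.-1 == m) ->
    maxn (natdist u.*2 n.-1) (natdist v.*2 n.-1) = m)%N.
  by move=> ? ? /orP[] /eqP ?; apply/eqP; rewrite eqn_leq geq_max leq_max; lia.
(* The main diagonals of the square cut it into four triangles. The triangle of (u, v) decides which
   signed offset is the maximum and which interval ends are cut off by the border. *)
case: (leqP u v) => uv; case: (leqP (u + v) n.-1) => uvn.
- by rewrite (maxE (n.-1 - u.*2)%N) ?(minn_idPl _); rewrite /natdist; lia.
- by rewrite (maxE (v.*2 - n.-1)%N) ?(minn_idPl (_ : u + (n - v) <= n)%N)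
    ?(minn_idPr (_ : n <= u + v.+1)%N); rewrite /natdist; lia.
- by rewrite (maxE (n.-1 - v.*2)%N) ?(minn_idPr (_ : n <= u + (n - v))%N)
    ?(minn_idPl (_ : u + v.+1 <= n)%N); rewrite /natdist; lia.
- by rewrite (maxE (u.*2 - n.-1)%N) ?(minn_idPr _); rewrite /natdist; lia.
Qed.

Definition attackers n (x : Defs.space n) : {set Defs.space n} :=
  [set a | line_queen_attacks a x]%SET.

Definition max_sum (i j k : nat) : nat := (maxn i j + maxn j k + maxn i k)%N.

(** Three rook lines of n spaces and three bishop planes of 2n - 1 - max spaces share only [x], so 5
    of its 6 occurrences are removed: 3n + 3(2n - 1) - 5 = 9n - 8. *)
Lemma card_attackers n (x : Defs.space n) (M := fun i => offcenter n (x i)) :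
  (#|attackers x| + max_sum (M ord0) (M (inord 1)) (M (inord 2)) + 8 = 9 * n)%N.
Proof.
set u := x ord0; set v := x (inord 1); set w := x (inord 2).
pose e (a b : 'I_n) : nat := (natdist a b == 0)%N.
pose p (a b c d : 'I_n) : nat := (natdist a b == natdist c d)%N.
have -> : #|attackers x| = (\sum_(a < n) \sum_(b < n) \sum_(c < n)
  [|| (natdist b v == 0) && (natdist c w == 0),
      (natdist a u == 0) && (natdist c w == 0),
      (natdist a u == 0) && (natdist b v == 0),
      (natdist a u == 0) && (natdist b v == natdist c w),
      (natdist b v == 0) && (natdist a u == natdist c w)
    | (natdist c w == 0) && (natdist a u == natdist b v)])%N.
  rewrite -big_space -sum1_card big_mkcond; apply: eq_bigr => a _.
  by rewrite inE line_queen_attacksE /= -/u -/v -/w; case: ifP.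
have se a : (\sum_(b < n) e b a = 1)%N by exact: sum_eq_ord.
(* Away from [x] at most one of the six conditions holds; at [x] all six do, hence the coefficient
   5. *)
have E : ((\sum_(a < n) \sum_(b < n) \sum_(c < n)
  [|| (natdist b v == 0) && (natdist c w == 0),
      (natdist a u == 0) && (natdist c w == 0),
      (natdist a u == 0) && (natdist b v == 0),
      (natdist a u == 0) && (natdist b v == natdist c w),
      (natdist b v == 0) && (natdist a u == natdist c w)
    | (natdist c w == 0) && (natdist a u == natdist b v)]) + 
   5 * \sum_(a < n) \sum_(b < n) \sum_(c < n) (e a u * (e b v * e c w)) =
   \sum_(a < n) \sum_(b < n) \sum_(c < n) (e b v * e c w)
 + \sum_(a < n) \sum_(b < n) \sum_(c < n) (e a u * e c w)
 + \sum_(a < n) \sum_(b < n) \sum_(c < n) (e a u * e b v)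
 + \sum_(a < n) \sum_(b < n) \sum_(c < n) (e a u * p b v c w)
 + \sum_(a < n) \sum_(b < n) \sum_(c < n) (e b v * p a u c w)
 + \sum_(a < n) \sum_(b < n) \sum_(c < n) (e c w * p a u b v))%N.
  rewrite big_distrr -!big_split /=; apply: eq_bigr => a _.
  rewrite big_distrr -!big_split /=; apply: eq_bigr => b _.
  rewrite big_distrr -!big_split /=; apply: eq_bigr => c _.
  rewrite /e /p.
  by case: (natdist a u) => [|s0]; case: (natdist b v) => [|s1];
     case: (natdist c w) => [|s2]; rewrite ?eqxx /= ?eqSS; do ?[case: eqP].
have cst m : (\sum_(a < n) m = n * m)%N by rewrite big_const_ord iter_addn_0 mulnC.
have H0 : (\sum_(a < n) \sum_(b < n) \sum_(c < n) (e a u * (e b v * e c w)) = 1)%N.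
  under eq_bigr => a _ do under eq_bigr => b _ do rewrite -!big_distrr /= se muln1.
  by under eq_bigr => a _ do rewrite -big_distrr /= se muln1.
have H1 : (\sum_(a < n) \sum_(b < n) \sum_(c < n) (e b v * e c w) = n)%N.
  under eq_bigr => a _ do under eq_bigr => b _ do rewrite -!big_distrr /= se muln1.
  by under eq_bigr => a _ do rewrite se; rewrite cst muln1.
have H2 : (\sum_(a < n) \sum_(b < n) \sum_(c < n) (e a u * e c w) = n)%N.
  under eq_bigr => a _ do under eq_bigr => b _ do rewrite -!big_distrr /= se muln1.
  by under eq_bigr => a _ do rewrite cst; rewrite -big_distrr /= se muln1.
have H3 : (\sum_(a < n) \sum_(b < n) \sum_(c < n) (e a u * e b v) = n)%N.
  under eq_bigr => a _ do under eq_bigr => b _ do rewrite cst mulnCA.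
  under eq_bigr => a _ do rewrite -!big_distrr /= se muln1 mulnC.
  by rewrite -big_distrr /= se muln1.
have H4 : (\sum_(a < n) \sum_(b < n) \sum_(c < n) (e a u * p b v c w) =
   \sum_(b < n) \sum_(c < n) p b v c w)%N.
  under eq_bigr => a _ do under eq_bigr => b _ do rewrite -!big_distrr /=.
  under eq_bigr => a _ do rewrite -!big_distrr /=.
  by rewrite -big_distrl /= se mul1n.
have H5 : (\sum_(a < n) \sum_(b < n) \sum_(c < n) (e b v * p a u c w) =
   \sum_(b < n) \sum_(c < n) p b u c w)%N.
  under eq_bigr => a _ do under eq_bigr => b _ do rewrite -!big_distrr /=.
  by under eq_bigr => a _ do rewrite -!big_distrl /= se mul1n.
have H6 : (\sum_(a < n) \sum_(b < n) \sum_(c < n) (e c w * p a u b v) =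
   \sum_(b < n) \sum_(c < n) p b u c v)%N.
  by under eq_bigr => a _ do under eq_bigr => b _ do rewrite -!big_distrl /= se mul1n.
rewrite {}H0 {}H1 {}H2 {}H3 {}H4 {}H5 {}H6 in E.
have := card_bishop_plane v w; have := card_bishop_plane u w.
have := card_bishop_plane u v; rewrite /max_sum /M -/u -/v -/w.
move: E; rewrite /p; lia.
Qed.

(** * Linearity of expectation *)

Lemma card_space n : #|{: Defs.space n}| = (n ^ 3)%N.
Proof. by rewrite card_ffun !card_ord. Qed.

(** Since [x] belongs to [attackers x], avoiding that set includes leaving [x] unoccupied. *)
Lemma in_safe_spaces n (A : {set Defs.space n}) x :
  (x \in safe_spaces A) = (A \subset ~: attackers x)%SET.
Proof.
have selfx : line_queen_attacks x x.
  by rewrite line_queen_attacksE /= /natdist; lia.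
rewrite inE; apply/andP/fintype.subsetP => [[_ /'forall_implyP H] a /H|H].
  by rewrite !inE.
split; first by apply/negP => /H; rewrite !inE selfx.
by apply/'forall_implyP => a /H; rewrite !inE.
Qed.

Lemma expected_safe_countE (R : realType) n m :
  expected_safe_count R n m = \sum_(x : Defs.space n)
    'C((n ^ 3 - #|attackers x|)%N, m)%:R / 'C((n ^ 3)%N, m)%:R.
Proof.
rewrite /expected_safe_count.
under eq_bigr => A _ do rewrite -sum1_card natr_sum big_distrr big_mkcond /=.
rewrite exchange_big /=; apply: eq_bigr => x _.
rewrite -card_space -(cardsC (attackers x)) addKn -cards_draws mulrC.
rewrite -[X in _ = _ * X%:R]sum1_card natr_sum big_distrr [RHS]big_mkcond /=.
apply: eq_bigr => A _; rewrite in_safe_spaces inE /placement_prob.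
by rewrite -card_space -(cardsC (attackers x)); do 2?case: ifP; rewrite ?mul0r.
Qed.

(** * Exponential bounds for quotients of binomial coefficients *)

Lemma bin_predE (R : realType) (N m : nat) : (0 < N)%N -> (m <= N)%N ->
  'C(N.-1, m)%:R = (1 - m%:R / N%:R) * 'C(N, m)%:R :> R.
Proof.
move=> N0 mN; have N0' : N%:R != 0 :> R by rewrite pnatr_eq0 -lt0n.
apply: (mulfI N0'); rewrite mulrA mulrBr mulr1 mulrCA divff// mulr1.
by rewrite -natrM mul_bin_down natrM natrB.
Qed.

(** Removing spaces one at a time gives factors 1 - m / (N - D), each at most 1 - m / N and so at
    most exp(- m / N). *)
Lemma bin_sub_le (R : realType) (N m D : nat) : (D + m <= N)%N ->
  'C((N - D)%N, m)%:R <= expR (- (D%:R * (m%:R / N%:R))) * 'C(N, m)%:R :> R.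
Proof.
elim: D => [|D IH] le_N; first by rewrite subn0 mul0r oppr0 expR0 mul1r.
have le_N' : (D + m <= N)%N by lia.
have ? : (0 < N - D)%N by lia.
rewrite subnS bin_predE//; last by lia.
have -> : D.+1%:R * (m%:R / N%:R) =
    m%:R / N%:R + D%:R * (m%:R / N%:R) :> R.
  by rewrite -[D.+1%:R]natr1; ring.
rewrite opprD expRD -mulrA.
apply: ler_pM => //; last exact: IH.
  by rewrite subr_ge0 ler_pdivrMr ?ltr0n// mul1r ler_nat; lia.
apply: le_trans (expR_ge1Dx _); rewrite lerD2l lerN2.
by rewrite ler_wpM2l// lef_pV2 ?posrE ?ltr0n ?ler_nat; lia.
Qed.

(* From [1 + x <= exp x] at [x = y / (1 - y)], taking inverses. *)
Lemma expR_le1B (R : realType) (y : R) : y < 1 -> expR (- (y / (1 - y))) <= 1 - y.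
Proof.
move=> y1; have y0 : 0 < 1 - y by rewrite subr_gt0.
rewrite expRN -[leRHS]invrK lef_pV2 ?posrE ?expR_gt0 ?invr_gt0//.
apply: le_trans (expR_ge1Dx _).
by rewrite -[X in _ <= X + _](@divff _ (1 - y)) ?gt_eqF// -mulrDl subrK mul1r.
Qed.

(** Each factor 1 - y with y = m / (N - D) is at least exp(- y / (1 - y)), and y / (1 - y) = m / (N
    - D - m). The bound [K] makes this rate independent of [D]. *)
Lemma bin_sub_ge (R : realType) (N m K D : nat) : (D <= K)%N -> (K + m < N)%N ->
  expR (- (D%:R * (m%:R / (N - K - m)%:R))) * 'C(N, m)%:R <= 'C((N - D)%N, m)%:R :> R.
Proof.
move=> + KN; elim: D => [|D IH] le_K; first by rewrite subn0 mul0r oppr0 expR0 mul1r.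
have ? : (0 < N - D)%N by lia.
have ND0 : 0 < (N - D)%:R :> R by rewrite ltr0n.
have mND : m%:R < (N - D)%:R :> R by rewrite ltr_nat; lia.
rewrite subnS bin_predE//; last by lia.
have -> : D.+1%:R * (m%:R / (N - K - m)%:R) =
    m%:R / (N - K - m)%:R + D%:R * (m%:R / (N - K - m)%:R) :> R.
  by rewrite -[D.+1%:R]natr1; ring.
rewrite opprD expRD -mulrA.
apply: ler_pM; rewrite ?expR_ge0 ?mulr_ge0 ?expR_ge0//; last by apply: IH; lia.
apply: le_trans (expR_le1B _); last by rewrite ltr_pdivrMr// mul1r.
rewrite ler_expR lerN2.
have -> : m%:R / (N - D)%:R / (1 - m%:R / (N - D)%:R) = m%:R / (N - D - m)%:R :> R.
  rewrite (@natrB _ (N - D)); last by lia.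
  by field; rewrite !gt_eqF ?subr_gt0.
by rewrite ler_wpM2l// lef_pV2 ?posrE ?ltr0n ?ler_nat; lia.
Qed.

(** * Replacing distances from the centre by coordinates *)

(* Rank of the coordinate x when 0, ..., n-1 are sorted by distance from the
   centre, ties broken in favour of the larger coordinate. *)
Definition center_rank (n x : nat) : nat :=
  if (n.-1 < x.*2)%N then (x.*2 - n)%N else (n.-1 - x.*2)%N.

Lemma center_rank_subproof n (x : 'I_n) : (center_rank n x < n)%N.
Proof. by have := ltn_ord x; rewrite /center_rank; case: ifP; lia. Qed.

Definition center_rank_ord n (x : 'I_n) : 'I_n := Ordinal (center_rank_subproof x).

(* The two branches of [center_rank] take values of opposite parity. *)
Lemma center_rank_ord_inj n : injective (@center_rank_ord n).
Proof.
move=> x y /(congr1 val) /=; rewrite /center_rank => E; apply: val_inj => /=.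
by have := (ltn_ord x, ltn_ord y); move: E; case: ifP; case: ifP; lia.
Qed.

(** The rank equals the offset in the lower half and is one less in the upper half. *)
Lemma center_rank_offcenter n x :
  (x < n)%N -> (center_rank n x <= offcenter n x <= (center_rank n x).+1)%N.
Proof. by rewrite /center_rank /offcenter /natdist; case: ifP; lia. Qed.

Lemma max_sum_bounds i j k i' j' k' :
  (i <= i' <= i.+1)%N -> (j <= j' <= j.+1)%N -> (k <= k' <= k.+1)%N ->
  (max_sum i j k <= max_sum i' j' k' <= 3 + max_sum i j k)%N.
Proof.
have maxS a b a' b' : (a <= a' <= a.+1)%N -> (b <= b' <= b.+1)%N ->
  (maxn a b <= maxn a' b' <= (maxn a b).+1)%N by lia.
move=> hi hj hk; have := maxS _ _ _ _ hi hk; have := maxS _ _ _ _ hj hk.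
have := maxS _ _ _ _ hi hj; rewrite /max_sum; clear.
(* Generalizing the maxima leaves purely linear arithmetic. *)
by do 6 (set m := maxn _ _; move: m); lia.
Qed.

(** [center_rank] permutes the coordinates, so [S] can be reindexed by it; each of the three maxima
    then errs by at most 1, whence the factor e^(3/n). *)
Lemma sum_offcenter_bounds (R : realType) n
    (S := \sum_(i < n) \sum_(j < n) \sum_(k < n) expR ((max_sum i j k)%:R / n%:R) : R)
    (T := \sum_(x : Defs.space n) expR ((max_sum (offcenter n (x ord0))
       (offcenter n (x (inord 1))) (offcenter n (x (inord 2))))%:R / n%:R) : R) :
  S <= T <= expR (3 / n%:R) * S.
Proof.
have -> : S = \sum_(x : Defs.space n) expR ((max_sum (center_rank n (x ord0))
       (center_rank n (x (inord 1))) (center_rank n (x (inord 2))))%:R / n%:R).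
  rewrite (big_space _ (fun i j k => expR ((max_sum (center_rank n i)
    (center_rank n j) (center_rank n k))%:R / n%:R))).
  rewrite /S (reindex_inj (@center_rank_ord_inj n)); apply: eq_bigr => i _.
  rewrite (reindex_inj (@center_rank_ord_inj n)); apply: eq_bigr => j _.
  by rewrite (reindex_inj (@center_rank_ord_inj n)).
rewrite mulr_sumr; apply/andP; split; apply: ler_sum => x _;
  rewrite -?expRD ler_expR -?mulrDl ler_wpM2r ?invr_ge0// -?natrD ler_nat;
  by have /andP[] := max_sum_bounds (center_rank_offcenter (ltn_ord (x ord0)))
    (center_rank_offcenter (ltn_ord (x (inord 1))))
    (center_rank_offcenter (ltn_ord (x (inord 2)))).
Qed.

(** * Closed forms for sums of powers of maxima *)

Lemma big_ord_recr2 (V : zmodType) (f : nat -> nat -> V) N :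
  \sum_(i < N.+1) \sum_(j < N.+1) f i j =
  \sum_(i < N) \sum_(j < N) f i j + \sum_(i < N) f i N + \sum_(j < N) f N j + f N N.
Proof.
rewrite big_ord_recr /= big_ord_recr /=.
by under eq_bigr => i _ do rewrite big_ord_recr /=; rewrite big_split /= !addrA.
Qed.

Section geometric_sums.
Variables (F : fieldType) (q : F).

(* These constants make (alpha k + beta) q^k and (alpha3 k + beta3) q^(3k) discrete
   antiderivatives of (2 k + 1) q^k and ((3 alpha + 3) k + 3 beta + 1) q^(3k). *)
Definition alpha : F := 2 / (q - 1).
Definition beta : F := (1 - alpha * q) / (q - 1).
Definition alpha3 : F := (3 * alpha + 3) / (q ^+ 3 - 1).
Definition beta3 : F := (3 * beta + 1 - alpha3 * q ^+ 3) / (q ^+ 3 - 1).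

(** Passing from N to N + 1 adds 2N + 1 pairs, all with maximum N. *)
Lemma sum_max2 N : q - 1 != 0 ->
  \sum_(i < N) \sum_(j < N) q ^+ maxn i j = (alpha * N%:R + beta) * q ^+ N - beta.
Proof.
move=> q1; elim: N => [|N IH].
  by rewrite big_ord0 expr0; ring.
rewrite (big_ord_recr2 (fun i j => q ^+ maxn i j)) IH maxnn.
under eq_bigr => i _ do rewrite (maxn_idPr (ltnW (ltn_ord i))).
under [X in _ + X + _]eq_bigr => i _ do rewrite (maxn_idPl (ltnW (ltn_ord i))).
rewrite sumr_const card_ord -mulr_natr -[N.+1%:R]natr1 exprSr /beta /alpha.
by field.
Qed.

(** The triples added at step N form three faces, three edges and a corner. Besides the q^(3N) terms
    they contribute -3 beta q^(2N), whose sum is the geometric quotient in q^2. *)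
Lemma sum_max_sum N : q - 1 != 0 -> q ^+ 2 - 1 != 0 -> q ^+ 3 - 1 != 0 ->
  \sum_(i < N) \sum_(j < N) \sum_(k < N) q ^+ max_sum i j k =
  (alpha3 * N%:R + beta3) * (q ^+ N) ^+ 3 - beta3 -
  3 * beta * (((q ^+ N) ^+ 2 - 1) / (q ^+ 2 - 1)).
Proof.
move=> q1 q2 q3; elim: N => [|N IH].
  by rewrite big_ord0 expr0; ring.
rewrite (big_ord_recr2 (fun i j => \sum_(k < N.+1) q ^+ max_sum i j k)).
under eq_bigr => i _ do under eq_bigr => j _ do rewrite big_ord_recr /=.
under eq_bigr => i _ do rewrite big_split /=.
rewrite big_split /= IH.
under [X in _ + X + _]eq_bigr => i _ do rewrite big_ord_recr /=.
under [X in _ + X + _ + _]eq_bigr => i _ do rewrite big_ord_recr /=.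
rewrite !big_split /= big_ord_recr /=.
have corner : (max_sum N N N = N * 3)%N by rewrite /max_sum; lia.
(* Faces: one coordinate is N, so two of the three maxima equal N and the third is handled by
   [sum_max2]. *)
have fE (g : nat -> nat -> nat) :
    (forall i j, (i < N)%N -> (j < N)%N -> g i j = N * 2 + maxn i j)%N ->
  \sum_(i < N) \sum_(j < N) q ^+ g i j =
  (q ^+ N) ^+ 2 * ((alpha * N%:R + beta) * q ^+ N - beta).
  move=> gE; rewrite -sum_max2// mulr_sumr; apply: eq_bigr => i _.
  by rewrite mulr_sumr; apply: eq_bigr => j _; rewrite gE// exprD exprM.
(* Edges: two coordinates are N, so all three maxima equal N. *)
have eE (g : nat -> nat) : (forall i, (i < N)%N -> g i = N * 3)%N ->
  \sum_(i < N) q ^+ g i = (q ^+ N) ^+ 3 * N%:R.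
  move=> gE; rewrite (eq_bigr (fun=> (q ^+ N) ^+ 3)) => [|i _].
    by rewrite sumr_const card_ord mulr_natr.
  by rewrite gE// exprM.
rewrite (fE (fun i j => max_sum i j N)); last by move=> i j ? ?; rewrite /max_sum; lia.
rewrite (fE (fun i j => max_sum i N j)); last by move=> i j ? ?; rewrite /max_sum; lia.
rewrite (fE (fun i j => max_sum N i j)); last by move=> i j ? ?; rewrite /max_sum; lia.
rewrite (eE (fun i => max_sum i N N)); last by move=> i ?; rewrite /max_sum; lia.
rewrite (eE (fun i => max_sum N i N)); last by move=> i ?; rewrite /max_sum; lia.
rewrite (eE (fun i => max_sum N N i)); last by move=> i ?; rewrite /max_sum; lia.
rewrite corner exprM -[N.+1%:R]natr1 [q ^+ N.+1]exprSr /beta3 /alpha3 /beta /alpha.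
set y := q ^+ N.
by field; rewrite q1 q2 q3.
Qed.
End geometric_sums.

(** * Elementary limits *)

Section limits.
Variable R : realType.

Lemma cvg_invn : (n%:R^-1 : R) @[n --> \oo] --> (0 : R).
Proof.
by apply/gtr0_cvgV0; [near=> n; rewrite ltr0n; near: n; exact: nbhs_infty_gt |
  exact: cvgr_idn].
Unshelve. all: by end_near. Qed.

Lemma cvg_expR_invn (c : R) : expR (c / n%:R) @[n --> \oo] --> (1 : R).
Proof.
rewrite -[X in _ --> X]expR0; apply: continuous_cvg; first exact: continuous_expR.
by rewrite -[X in _ --> X](mulr0 c); apply: cvgM; [exact: cvg_cst | exact: cvg_invn].
Qed.

(** Both bounds come from 1 + x <= exp x, taken at c / n and at - c / n. *)
Lemma cvg_expR_slope (c : R) : 0 <= c ->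
  n%:R * (expR (c / n%:R) - 1) @[n --> \oo] --> c.
Proof.
move=> c0; apply: (@squeeze_cvgr _ _ _ _ (fun=> c) (fun n => c / (1 - c / n%:R))).
- near=> n.
  have n0 : 0 < n%:R :> R by rewrite ltr0n; near: n; exact: nbhs_infty_gt.
  have cn : c < n%:R by near: n; exact: nbhs_infty_gtr.
  have x1 : c / n%:R < 1 by rewrite ltr_pdivrMr// mul1r.
  apply/andP; split.
    by rewrite -ler_pdivrMl// mulrC lerBrDl expR_ge1Dx.
  rewrite -ler_pdivlMl// lerBlDl.
  have -> : 1 + n%:R^-1 * (c / (1 - c / n%:R)) = (1 - c / n%:R)^-1.
    by field; rewrite !gt_eqF ?subr_gt0.
  rewrite -[leLHS]invrK lef_pV2 ?posrE ?subr_gt0 ?invr_gt0 ?expR_gt0//.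
  by rewrite -expRN expR_ge1Dx.
- exact: cvg_cst.
- rewrite -[X in _ --> X]mulr1; apply: cvgM; first exact: cvg_cst.
  rewrite -[X in _ --> X]invr1.
  apply: cvgV => //; rewrite -[X in _ --> X]subr0 ; apply: cvgB; first exact: cvg_cst.
  by rewrite -[X in _ --> X](mulr0 c); apply: cvgM; [exact: cvg_cst | exact: cvg_invn].
Unshelve. all: by end_near. Qed.

End limits.

(** * Limit of the normalized sum *)

Section limit_of_the_sum.
Variable R : realType.

Definition slope (c : R) (n : nat) : R := n%:R * (expR (c / n%:R) - 1).

(* At q = e^(1/n) these are alpha / n, beta / n^2, alpha3 / n^2, beta3 / n^3. *)
Definition scaled_alpha n : R := 2 / slope 1 n.
Definition scaled_beta n : R :=
  (n%:R^-1 - scaled_alpha n * expR (1 / n%:R)) / slope 1 n.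
Definition scaled_alpha3 n : R := (3 * scaled_alpha n + 3 / n%:R) / slope 3 n.
Definition scaled_beta3 n : R :=
  (3 * scaled_beta n + n%:R^-1 * n%:R^-1 - scaled_alpha3 n * expR (3 / n%:R)) / slope 3 n.

(** With q = e^(1/n) one has q^n = e, and the powers of n are distributed so that every factor has a
    finite limit. *)
Lemma sum_expR_max_sumE n : (0 < n)%N ->
  (\sum_(i < n) \sum_(j < n) \sum_(k < n) expR ((max_sum i j k)%:R / n%:R)) / n%:R ^+ 3 =
  (scaled_alpha3 n + scaled_beta3 n) * expR 1 ^+ 3 - scaled_beta3 n -
  3 * scaled_beta n * ((expR 1 ^+ 2 - 1) / slope 2 n).
Proof.
move=> n0; have nR0 : n%:R != 0 :> R by rewrite pnatr_eq0 -lt0n.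
pose q : R := expR (n%:R^-1).
have qE c : expR (c%:R / n%:R) = q ^+ c by rewrite /q -expRM_natl.
have q1 c : (0 < c)%N -> q ^+ c - 1 != 0.
  move=> c0; rewrite subr_eq0 -qE gt_eqF// expR_gt1 divr_gt0 ?ltr0n//.
have eE : expR 1 = q ^+ n by rewrite -qE divff.
under eq_bigr => i _ do under eq_bigr => j _ do under eq_bigr => k _ do rewrite qE.
rewrite sum_max_sum ?q1 ?(q1 1)// -eE.
rewrite /scaled_beta3 /scaled_alpha3 /scaled_beta /scaled_alpha /slope.
rewrite (qE 1) !qE expr1 /beta3 /alpha3 /beta /alpha.
by field; rewrite nR0 !q1// (q1 1).
Qed.

(** The scaled constants tend to 2, -2, 2 and -8/3 respectively. *)
Lemma cvg_sum_expR_max_sum :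
  ((\sum_(i < n) \sum_(j < n) \sum_(k < n) expR ((max_sum i j k)%:R / n%:R)) /
    n%:R ^+ 3 : R) @[n --> \oo] --> (- 1 + 9 * expR 1 ^+ 2 - 2 * expR 1 ^+ 3) / 3.
Proof.
have d0 := @cvg_invn R.
have e c := cvg_expR_invn (c : R).
have s c : (0 < c)%N -> (slope c%:R n)^-1 @[n --> \oo] --> (c%:R^-1 : R).
  by move=> c0; apply: cvgV; [rewrite pnatr_eq0 -lt0n | exact: cvg_expR_slope].
(* The limits are left unevaluated, in the shape produced by the limit rules, until [field]
   simplifies them. *)
have a1 : scaled_alpha n @[n --> \oo] --> (2 * 1^-1 : R).
  by apply: cvgM; [exact: cvg_cst | exact: (s 1)].
have b1 : scaled_beta n @[n --> \oo] --> ((0 - 2 * 1^-1 * 1) * 1^-1 : R).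
  by apply: cvgM; [apply: cvgB => //; exact: cvgM | exact: (s 1)].
have a3 : scaled_alpha3 n @[n --> \oo] --> ((3 * (2 * 1^-1) + 3 * 0) * 3^-1 : R).
  apply: cvgM; last exact: (s 3).
  by apply: cvgD; apply: cvgM => //; exact: cvg_cst.
have b3 : scaled_beta3 n @[n --> \oo] -->
    ((3 * ((0 - 2 * 1^-1 * 1) * 1^-1) + 0 * 0 - (3 * (2 * 1^-1) + 3 * 0) * 3^-1 * 1) * 3^-1 : R).
  apply: cvgM; last exact: (s 3).
  apply: cvgB; last exact: cvgM.
  by apply: cvgD; apply: cvgM => //; exact: cvg_cst.
set L := (X in _ --> X).
have -> : L =
  ((3 * (2 * 1^-1) + 3 * 0) * 3^-1 +
   (3 * ((0 - 2 * 1^-1 * 1) * 1^-1) + 0 * 0 - (3 * (2 * 1^-1) + 3 * 0) * 3^-1 * 1) * 3^-1) *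
  expR 1 ^+ 3 -
   (3 * ((0 - 2 * 1^-1 * 1) * 1^-1) + 0 * 0 - (3 * (2 * 1^-1) + 3 * 0) * 3^-1 * 1) * 3^-1 -
  3 * ((0 - 2 * 1^-1 * 1) * 1^-1) * ((expR 1 ^+ 2 - 1) * 2^-1).
  by rewrite /L; field.
apply: (cvg_trans (G := (scaled_alpha3 n + scaled_beta3 n) * expR 1 ^+ 3 - scaled_beta3 n -
  3 * scaled_beta n * ((expR 1 ^+ 2 - 1) / slope 2 n) @[n --> \oo])).
  apply: near_eq_cvg; near=> n; rewrite sum_expR_max_sumE//.
  by near: n; exact: nbhs_infty_gt.
apply: cvgB; first apply: cvgB => //.
  by apply: cvgM; [exact: cvgD | exact: cvg_cst].
apply: cvgM; first by apply: cvgM => //; exact: cvg_cst.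
by apply: cvgM; [exact: cvg_cst | exact: (s 2)].
Unshelve. all: by end_near. Qed.

End limit_of_the_sum.

(** * Squeezing the expected proportion *)

Lemma safe_proportion_bounds (R : realType) n (p := expected_safe_proportion R n (n ^ 2))
    (d : R := n%:R^-1)
    (S := (\sum_(i < n) \sum_(j < n) \sum_(k < n)
       expR ((max_sum i j k)%:R / n%:R)) / n%:R ^+ 3 : R) :
  (4 <= n)%N ->
  expR (- 9) * expR (9 - 9 * (1 - d - 9 * d ^+ 2)^-1) * S <= p <=
  expR (- 9) * expR (8 * d) * expR (3 * d) * S.
Proof.
move=> n4; have nR0 : 0 < n%:R :> R by rewrite ltr0n; lia.
have n3 : 0 < n%:R ^+ 3 :> R by rewrite exprn_gt0.
(* This is where 4 <= n is needed: the inequality fails at n = 3. *)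
have N0 : (9 * n + n ^ 2 < n ^ 3)%N by rewrite !expnS expn0; nia.
have NR : 0 < (n ^ 3 - 9 * n - n ^ 2)%:R :> R by rewrite ltr0n; lia.
have NRE : (n ^ 3 - 9 * n - n ^ 2)%:R = n%:R ^+ 3 - 9 * n%:R - n%:R ^+ 2 :> R.
  by rewrite !natrB ?natrM ?natrX//; lia.
have dE : n%:R * d = 1 by rewrite divff// gt_eqF.
have d0 : 0 < d by rewrite invr_gt0.
(* The lower bound is used with K = 9n, which gives the rate [d * w] in place of [d]. *)
set w := (1 - d - 9 * d ^+ 2)^-1.
have wE : n%:R ^+ 2 / (n ^ 3 - 9 * n - n ^ 2)%:R = d * w.
  rewrite /w; have -> : 1 - d - 9 * d ^+ 2 = (n ^ 3 - 9 * n - n ^ 2)%:R / n%:R ^+ 3.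
    by rewrite NRE /d; field; rewrite gt_eqF.
  by rewrite /d; field; rewrite !gt_eqF.
have w1 : 1 <= w.
  have -> : w = n%:R * (d * w) by rewrite mulrA dE mul1r.
  rewrite -wE mulrA ler_pdivlMr// mul1r -exprS -natrX ler_nat; lia.
pose f (x : Defs.space n) := max_sum (offcenter n (x ord0))
       (offcenter n (x (inord 1))) (offcenter n (x (inord 2))).
have cardE x : #|attackers x|%:R = 9 * n%:R - 8 - (f x)%:R :> R.
  by have /(congr1 (fun k => k%:R : R)) := card_attackers x; rewrite natrM !natrD -/(f x); lra.
have card_le (x : Defs.space n) : (#|attackers x| <= 9 * n)%N.
  by rewrite -(card_attackers x) -addnA leq_addr.
have /andP[lo hi] := sum_offcenter_bounds R n.
have dhi : (\sum_x expR ((f x)%:R / n%:R)) / n%:R ^+ 3 <= expR (3 * d) * S.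
  by rewrite mulrA ler_pM2r ?invr_gt0.
have dlo : S <= (\sum_x expR ((f x)%:R / n%:R)) / n%:R ^+ 3.
  by rewrite ler_pM2r ?invr_gt0.
have C0 : 0 < 'C((n ^ 3)%N, (n ^ 2)%N)%:R :> R by rewrite ltr0n bin_gt0 leq_pexp2l//; lia.
rewrite /p /expected_safe_proportion expected_safe_countE natrX.
apply/andP; split.
  apply: le_trans (_ : _ <= expR (- 9) * expR (9 - 9 * w) *
     ((\sum_x expR ((f x)%:R / n%:R)) / n%:R ^+ 3)) _.
    by rewrite ler_pM2l// mulr_gt0 ?expR_gt0.
  rewrite mulrA ler_pM2r ?invr_gt0// mulr_sumr; apply: ler_sum => x _.
  rewrite ler_pdivlMr//.
  apply: le_trans (bin_sub_ge R (card_le x) N0).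
  rewrite ler_pM2r// -!expRD ler_expR natrX wE cardE.
  have -> : - ((9 * n%:R - 8 - (f x)%:R) * (d * w)) =
    - (9 * (n%:R * d) * w) + (8 + (f x)%:R) * d * w by ring.
  (* In the positive part of the exponent [w] is lowered to 1 and the 8 is dropped; the main term
     keeps [w], giving the factor exp(9 - 9w). *)
  have : (f x)%:R * d <= (8 + (f x)%:R) * d * w.
    apply: le_trans (_ : _ <= (8 + (f x)%:R) * d) _.
      by rewrite ler_pM2r// lerDr.
    by rewrite ler_peMr// mulr_ge0 ?(ltW d0)// addr_ge0.
  by rewrite dE mulr1 -/d; lra.
rewrite -!mulrA; apply: le_trans (_ : _ <= expR (- 9) * (expR (8 * d) *
     ((\sum_x expR ((f x)%:R / n%:R)) / n%:R ^+ 3))) _; last first.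
  by rewrite !ler_pM2l ?expR_gt0.
rewrite !mulrA ler_pM2r ?invr_gt0// mulr_sumr; apply: ler_sum => x _.
rewrite ler_pdivrMr//.
apply: le_trans (bin_sub_le R _) _; first by rewrite (leq_trans _ (ltnW N0))// leq_add2r.
rewrite ler_pM2r// -!expRD ler_expR cardE !natrX /d.
(* The exponents agree exactly: e^(8d) accounts for the 8 in the attacker count. *)
rewrite le_eqVlt; apply/orP; left; apply/eqP.
by field; rewrite gt_eqF.
Qed.

Theorem mainTheorem7 (R : realType) :
  expected_safe_proportion R n (n ^ 2)%N @[n --> \oo] -->
    (- 1 + 9 * expR 1 ^+ 2 - 2 * expR 1 ^+ 3) / (3 * expR 1 ^+ 9).
Proof.
set L := (- 1 + 9 * expR 1 ^+ 2 - 2 * expR 1 ^+ 3) / 3 : R.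
have -> : (- 1 + 9 * expR 1 ^+ 2 - 2 * expR 1 ^+ 3) / (3 * expR 1 ^+ 9) =
    expR (- 9) * L :> R.
  by rewrite expRN -[9]mulr1 expRM_natl /L; field; rewrite gt_eqF ?expR_gt0.
have d0 := @cvg_invn R.
have e c := @cvg_expR_invn R c.
have sumL := @cvg_sum_expR_max_sum R.
(* The correction factor of the lower bound tends to exp(9 - 9) = 1. *)
have w1 : expR (9 - 9 * (1 - n%:R^-1 - 9 * n%:R^-1 ^+ 2)^-1) @[n --> \oo] --> (1 : R).
  rewrite -[X in _ --> X]expR0 -[X in _ --> expR X](subrr 9); apply: continuous_cvg.
    exact: continuous_expR.
  apply: cvgB; first exact: cvg_cst.
  rewrite -[X in _ --> X]mulr1; apply: cvgM; first exact: cvg_cst.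
  rewrite -[X in _ --> X]invr1; apply: cvgV; first exact: oner_neq0.
  have one : 1 - 0 - 9 * (0 * 0) = 1 :> R by ring.
  rewrite -[X in _ --> X]one.
  apply: cvgB; first by apply: cvgB => //; exact: cvg_cst.
  by apply: cvgM; [exact: cvg_cst | exact: cvgM].
apply: (squeeze_cvgr _ (_ : _ --> expR (- 9) * L) (_ : _ --> expR (- 9) * L)).
- near=> n; apply: safe_proportion_bounds.
  by near: n; exact: nbhs_infty_ge.
- have <- : expR (- 9) * 1 * L = expR (- 9) * L by rewrite mulr1.
  apply: cvgM => //.
  by apply: cvgM => //; exact: cvg_cst.
- have <- : expR (- 9) * 1 * 1 * L = expR (- 9) * L by rewrite !mulr1.
  apply: cvgM => //.
  by apply: cvgM => //; apply: cvgM => //; exact: cvg_cst.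
Unshelve. all: by end_near. Qed.
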